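(* For every real $x$ and every integer $n\ge 0$, $$\sum_{m=0}^{n}\binom{n}{m}\phi_{m,\lambda}^{Y}(1-x)\,\mathcal{E}_{n-m,\lambda}^{Y}=2e^{x-1}\sum_{m=0}^{\infty}\frac{(-1)^{m}}{m!}d_{m}(x)\,E\big[(S_{m})_{n,\lambda}\big].$$
   Context: Let $\lambda$ be a nonzero real number. Set $(x)_{0,\lambda}=1$ and $(x)_{k,\lambda}=x(x-\lambda)\cdots(x-(k-1)\lambda)$ for $k\ge 1$. The degenerate exponential is $e_{\lambda}^{x}(t)=\sum_{k\ge 0}(x)_{k,\lambda}\frac{t^{k}}{k!}$ (so $e_\lambda^x(t)=(1+\lambda t)^{x/\lambda}$ for $t$ near $0$). All generating functions below are power series in $t$ near $0$. $Y$ is a real random variable whose moment generating function $E[e^{tY}]=\sum_{n\ge 0}E[Y^n]\frac{t^n}{n!}$ exists for $|t|<r$, for some $r>0$. $E$ denotes expectation. $(Y_j)_{j\ge 1}$ is a sequence of mutually independent copies of $Y$, $S_0=0$ and $S_k=Y_1+\cdots+Y_k$ for $k\ge 1$. The derangement polynomials $d_n(x)$ are defined by $\frac{1}{1-t}e^{(x-1)t}=\sum_{n\ge 0}d_{n}(x)\frac{t^{n}}{n!}$. The probabilistic degenerate Stirling numbers of the second kind associated with $Y$ are $${n \brace k}_{Y,\lambda}=\frac{1}{k!}\sum_{j=0}^{k}\binom{k}{j}(-1)^{k-j}E\big[(S_{j})_{n,\lambda}\big]\quad (n\ge k\ge 0),$$ and the probabilistic degenerate Bell polynomials associated with $Y$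 are $\phi_{n,\lambda}^{Y}(x)=\sum_{k=0}^{n}{n\brace k}_{Y,\lambda}x^{k}$ ($n\ge 0$). The probabilistic degenerate Euler numbers associated with $Y$, $\mathcal{E}_{n,\lambda}^{Y}$, are defined by $$\frac{2}{E[e_{\lambda}^{Y}(t)]+1}=\sum_{n=0}^{\infty}\mathcal{E}_{n,\lambda}^{Y}\frac{t^{n}}{n!}.$$
   Formalization: The infinite series on the right is taken as an Abel sum (proved to exist), since its ordinary partial sums diverge, e.g. always for n=0 because d_m(x)/m! tends to e^{x-1}, which is nonzero; when the series converges, the Abel sum equals its ordinary sum. *)

(* Defs.v *)
From HB Require Import structures.
From mathcomp Require Import all_boot all_order all_algebra.
From mathcomp Require Import all_classical all_reals all_analysis.

Set Implicit Arguments.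
Unset Strict Implicit.
Unset Printing Implicit Defensive.

Import Order.TTheory GRing.Theory Num.Theory.
Import numFieldNormedType.Exports.

Local Open Scope classical_set_scope.
Local Open Scope ring_scope.

Section PowerSeries.
Context {R : realType}.
Implicit Types (a : R^nat) (f : R -> R).

(* f(t) = \sum_n a_n t^n / n! as convergent power series, for all t near 0;
   this determines the sequence a. *)
Definition is_egf a f : Prop :=
  \forall t \near (0 : R),
    series (fun n => a n * (t ^+ n / n`!%:R)) @ \oo --> f t.

(* The series \sum_m (-1)^m d_m(x) / m! E[(S_m)_{n,lam}] is the expansion of a
   function on the boundary of its disc of convergence: d_m(x) / m! tends to
   e^(x - 1) <> 0, so for n = 0 the partial sums always diverge. Its sum is taken
   in the sense of Abel, which agrees with the ordinary sum of any convergent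
   series. *)
Definition abel_mean a (r : R) : R := limn (series (fun m => a m * r ^+ m)).

Definition abel_summable a : Prop :=
  (forall r : R, 0 <= r < 1 -> cvgn (series (fun m => a m * r ^+ m))) /\
  cvg (abel_mean a r @[r --> (1 : R)^'-]).

Definition abel_sum a : R := lim (abel_mean a r @[r --> (1 : R)^'-]).

End PowerSeries.

Section Degenerate.
Context {R : realType}.
Implicit Types (lam x t : R).

Definition dfact lam x (k : nat) : R := \prod_(i < k) (x - i%:R * lam).

Definition dexp lam x t : R :=
  limn (series (fun k => dfact lam x k * (t ^+ k / k`!%:R))).

End Degenerate.

Section Probabilistic.
Context {d : measure_display} {T : measurableType d} {R : realType}.
Variable P : probability T R.

Definition mutually_independent (X : {RV P >-> R}^nat) : Prop :=
  forall (J : seq nat) (B : nat -> set R),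
    uniq J -> (forall j, measurable (B j)) ->
    P (\bigcap_(j in [set` J]) (X j @^-1` B j)) =
    (\prod_(j <- J) P (X j @^-1` B j))%E.

Definition same_law (X Y : {RV P >-> R}) : Prop :=
  forall B : set R, measurable B -> distribution P X B = distribution P Y B.

(* The summands are numbered from 0. *)
Definition partial_sum (X : {RV P >-> R}^nat) (k : nat) : T -> R :=
  fun w => \sum_(j < k) X j w.

Definition dmoment (lam : R) (X : {RV P >-> R}^nat) (k n : nat) : R :=
  fine 'E_P[fun w => dfact lam (partial_sum X k w) n].

Definition stirling2 (lam : R) (X : {RV P >-> R}^nat) (n k : nat) : R :=
  (k`!%:R)^-1 *
  \sum_(j < k.+1) 'C(k, j)%:R * (-1) ^+ (k - j) * dmoment lam X j n.

Definition bell (lam : R) (X : {RV P >-> R}^nat) (n : nat) (x : R) : R :=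
  \sum_(k < n.+1) stirling2 lam X n k * x ^+ k.

Definition is_euler_numbers (lam : R) (Y : {RV P >-> R}) (e : R^nat) : Prop :=
  is_egf e (fun t => 2 / (fine 'E_P[fun w => dexp lam (Y w) t] + 1)).

End Probabilistic.

Definition is_derangement_polynomials (R : realType) (D : nat -> R -> R) : Prop :=
  forall x : R,
    is_egf (fun n => D n x) (fun t => (1 - t)^-1 * expR ((x - 1) * t)).

(* Main.v *)
Require Import Defs.
From HB Require Import structures.
From mathcomp Require Import all_boot all_order all_algebra.
From mathcomp Require Import all_classical all_reals all_analysis.
From mathcomp Require Import measurable_realfun ring lra.

Set Implicit Arguments.
Unset Strict Implicit.
Unset Printing Implicit Defensive.

Import Order.TTheory GRing.Theory Num.Theory.
Import numFieldNormedType.Exports.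

Local Open Scope classical_set_scope.
Local Open Scope ring_scope.

(** Write M(t) = E[e_lam^Y(t)] and U(t) = M(t) - 1.  Since the Y_j are independent
copies of Y and e_lam^(u+v) = e_lam^u e_lam^v, the numbers E[(S_m)_{n,lam}] are
the exponential coefficients of M(t)^m = (1 + U(t))^m.  As U(0) = 0, the binomial
theorem turns this into the finite sum

  E[(S_m)_{n,lam}] / n! = \sum_(j <= n) 'C(m, j) [t^n] U^j,

a polynomial in m; binomial inversion gives S2(n, k) = n!/k! [t^n] U^k, so that
the Bell polynomials at y = 1 - x have generating function exp(y U(t)).  The left
side is therefore n! times the coefficient of t^n in 2 exp(y U) / (2 + U).

On the right side, put delta_m = (-1)^m d_m(x) / m!.  By the polynomial formula
above it suffices to sum, for each j, the series of 'C(m, j) delta_m.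
The generating function of the derangement polynomials amounts to
delta_(m+1) + delta_m = y^(m+1) / (m+1)!, and with Pascal's rule this becomes a
recurrence in j for the Abel means A_j(r) = \sum_m 'C(m, j) delta_m r^m,

  (1 + r) A_j(r) + r A_(j-1)(r) = e^(y r) (y r)^j / j!.

Letting r tend to 1 from the left yields limits with
2 A_j + A_(j-1) = e^y y^j / j!.  This says exactly that the series
W = 2 e^(x - 1) \sum_j A_j U^j satisfies (2 + U) W = 2 exp(y U), which identifies
both sides.

Three analytic facts support this.  Expectation and the series of e_lam^Z(t) may
be exchanged by dominated convergence: (Z)_{k,lam} is bounded by k! e^(c|Z|) times
the k-th power of a constant, and e^(c|Z|) is integrable (expansion_moment).
The expectation of e_lam^(S_m)(t) factors: since e_lam^Y(t) is a square, hence
nonnegative, only the product rule for nonnegative functions of independent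
variables is needed (indep_expectation_prod_indic).  Identities between
convergent power series near 0 are transferred to their coefficients by
expansionM and eq_expansion, and the coefficients are then handled in {poly R},
truncated above degree n. *)

(** * Power series near 0 *)

Section PowerSeries.
Context {R : realType}.
Implicit Types (a b c : R^nat) (f g : R -> R) (t : R).

Definition conv a b : R^nat := fun n => \sum_(k < n.+1) a k * b (n - k)%N.

Definition expansion c f : Prop :=
  \forall t \near (0 : R), series (fun n => c n * t ^+ n) @ \oo --> f t.

Lemma is_egf_expansion a f :
  is_egf a f -> expansion (fun n => a n / n`!%:R) f.
Proof.
move=> h; near=> t.
rewrite (_ : (fun n => _) = (fun n => a n * (t ^+ n / n`!%:R))).
  by near: t.
by apply/funext => n; rewrite mulrAC mulrA.
Unshelve. all: by end_near. Qed.

Lemma expansion_at c f : expansion c f ->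
  exists2 t0, 0 < t0 & forall t, `|t| <= t0 ->
    series (fun n => c n * t ^+ n) @ \oo --> f t.
Proof.
case/nbhs_ballP => e /= e0 he; exists (e / 2); first by rewrite divr_gt0.
move=> t te; apply: he; rewrite /ball /= sub0r normrN.
by rewrite (le_lt_trans te)// ltr_pdivrMr// ltr_pMr// ltr1n.
Qed.

(** Convergence at a single nonzero point already bounds the coefficients
geometrically; this is what makes all later rearrangements absolute. *)
Lemma expansion_bound c f : expansion c f ->
  exists A K, [/\ 0 < A, 0 < K & forall n, `|c n| <= A * K ^+ n].
Proof.
case/expansion_at => t0 t0_gt0 /(_ t0).
rewrite ger0_norm ?(ltW t0_gt0)// => /(_ (lexx _)) /cvgP /cvg_series_bounded.
case=> M [Mr Mb]; exists (`|M| + 1), t0^-1; split.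
- by rewrite ltr_wpDl.
- by rewrite invr_gt0.
move=> n; rewrite exprVn ler_pdivlMr ?exprn_gt0//.
rewrite -{1}(ger0_norm (ltW t0_gt0)) -normrX -normrM.
by apply: Mb => //; rewrite (le_lt_trans (ler_norm M))// ltrDl.
Qed.

Lemma half_expr_cvg0 (A : R) : (fun n => A * (2^-1) ^+ n) @ \oo --> (0 : R).
Proof.
apply: (@cvg_geometric R A 2^-1).
by rewrite gtr0_norm ?invr_gt0// invf_lt1// ltr1n.
Qed.

(** Comparing with polynomials avoids reindexing double sums: the product of the
N-th partial sums is the value at 1 of the product of two truncations, which
agrees with the convolution in degrees below N.  The N remaining coefficients
are each at most A^2 4^-N, hence negligible.  The ratio 1/8 leaves room for the
factors n + 1 and N, both bounded by powers of 2. *)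
Lemma cauchy_product a b (A la lb : R) :
    (forall n, `|a n| <= A * 8^-1 ^+ n) -> (forall n, `|b n| <= A * 8^-1 ^+ n) ->
    series a @ \oo --> la -> series b @ \oo --> lb ->
  series (conv a b) @ \oo --> la * lb.
Proof.
move=> ha hb ca cb.
have A0 : 0 <= A by have := le_trans (normr_ge0 _) (ha 0%N); rewrite expr0 mulr1.
suff h0 : (fun N => series a N * series b N - series (conv a b) N) @ \oo --> (0 : R).
  rewrite -[la * lb]subr0 (_ : series (conv a b) = (fun N =>
     series a N * series b N - (series a N * series b N - series (conv a b) N))).
    by apply: cvgB => //; apply: cvgM.
  by apply/funext => N; rewrite opprB addrC subrK.
have key N : `|series a N * series b N - series (conv a b) N| <= A ^+ 2 * 2^-1 ^+ N.
  pose p := \poly_(i < N) a i; pose q := \poly_(i < N) b i.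
  have pb i : `|p`_i| <= A * 8^-1 ^+ i.
    by rewrite coef_poly; case: ifP => // _; rewrite normr0 mulr_ge0// exprn_ge0.
  have qb i : `|q`_i| <= A * 8^-1 ^+ i.
    by rewrite coef_poly; case: ifP => // _; rewrite normr0 mulr_ge0// exprn_ge0.
  have pqb n : `|(p * q)`_n| <= A ^+ 2 * 4^-1 ^+ n.
    rewrite coefM (le_trans (ler_norm_sum _ _ _))//.
    have : \sum_(j < n.+1) `|p`_j * q`_(n - j)| <= \sum_(j < n.+1) A ^+ 2 * 8^-1 ^+ n.
      apply: ler_sum => j _; rewrite normrM expr2.
      rewrite -[in 8^-1 ^+ n](@subnKC j n) -1?ltnS// exprD mulrACA.
      exact: ler_pM.
    move=> /le_trans; apply; rewrite sumr_const card_ord -[leLHS]mulr_natr -mulrA.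
    rewrite ler_wpM2l ?sqr_ge0//.
    rewrite (_ : 4^-1 = 8^-1 * 2 :> R); last by field.
    rewrite exprMn ler_wpM2l ?exprn_ge0//.
    by rewrite -natrX ler_nat ltn_expl.
  have -> : series a N * series b N = \sum_(i < N + N) (p * q)`_i.
    have ev (u : R^nat) : series u N = (\poly_(i < N) u i).[1].
      rewrite /series /= horner_poly big_mkord; apply: eq_bigr => i _.
      by rewrite expr1n mulr1.
    rewrite !ev -hornerM (@horner_coef_wide _ (N + N)).
      by apply: eq_bigr => i _; rewrite expr1n mulr1.
    rewrite (leq_trans (size_polyMleq _ _))//.
    by rewrite (leq_trans (leq_pred _))// leq_add// size_poly.
  have -> : series (conv a b) N = \sum_(i < N) (p * q)`_i.
    rewrite /series /= big_mkord; apply: eq_bigr => i _.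
    rewrite coefM; apply: eq_bigr => j _; rewrite !coef_poly.
    have jN : (j < N)%N by rewrite (leq_ltn_trans _ (ltn_ord i))// -ltnS.
    by rewrite jN (leq_ltn_trans (leq_subr _ _) (ltn_ord i)).
  rewrite big_split_ord /= addrAC subrr add0r (le_trans (ler_norm_sum _ _ _))//.
  have : \sum_(i < N) `|(p * q)`_(N + i)| <= \sum_(i < N) A ^+ 2 * 4^-1 ^+ N.
    apply: ler_sum => i _; apply: (le_trans (pqb _)).
    rewrite ler_wpM2l ?sqr_ge0// exprD ler_piMr ?exprn_ge0//.
    by rewrite exprn_ile1// invf_le1// ler1n.
  move=> /le_trans; apply; rewrite sumr_const card_ord -[leLHS]mulr_natr -mulrA.
  rewrite ler_wpM2l ?sqr_ge0// (_ : 2^-1 = 4^-1 * 2 :> R); last by field.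
  by rewrite exprMn ler_wpM2l ?exprn_ge0// -natrX ler_nat ltnW// ltn_expl.
apply/norm_cvg0P.
apply: (@squeeze_cvgr _ _ _ _ (fun=> 0) (fun N => A ^+ 2 * 2^-1 ^+ N)).
- by apply: nearW => N; rewrite normr_ge0 key.
- exact: cvg_cst.
- exact: half_expr_cvg0.
Qed.

Lemma expansionM a b f g : expansion a f -> expansion b g ->
  expansion (conv a b) (fun t => f t * g t).
Proof.
move=> ha hb.
have [A [K [A0 K0 aK]]] := expansion_bound ha.
have [B [L [B0 L0 bL]]] := expansion_bound hb.
near=> t.
have -> : (fun n => conv a b n * t ^+ n) =
    conv (fun n => a n * t ^+ n) (fun n => b n * t ^+ n).
  apply/funext => n; rewrite /conv mulr_suml; apply: eq_bigr => k _.
  by rewrite mulrACA -exprD subnKC// -ltnS.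
have tKL : `|t| <= (8 * (K + L))^-1.
  near: t; exists ((8 * (K + L))^-1) => /=.
    by rewrite invr_gt0 mulr_gt0// addr_gt0.
  by move=> y /=; rewrite sub0r normrN => /ltW.
have bd (u : R^nat) (C M : R) : 0 < C -> C <= A + B -> 0 < M -> M <= K + L ->
    (forall n, `|u n| <= C * M ^+ n) ->
    forall n, `|u n * t ^+ n| <= (A + B) * 8^-1 ^+ n.
  move=> C0 CA M0 MK uM n; rewrite normrM normrX.
  apply: (@le_trans _ _ (C * M ^+ n * (8 * (K + L))^-1 ^+ n)).
    by rewrite ler_pM// lerXn2r// nnegrE// invr_ge0 mulr_ge0// ltW// addr_gt0.
  rewrite -mulrA -exprMn ler_pM//.
  - exact: ltW.
  - by rewrite exprn_ge0// mulr_ge0// ?(ltW M0)// invr_ge0 mulr_ge0// ltW// addr_gt0.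
  - rewrite lerXn2r// ?nnegrE//.
      by rewrite mulr_ge0// ?(ltW M0)// invr_ge0 mulr_ge0// ltW// addr_gt0.
    rewrite invfM mulrCA ler_piMr// ler_pdivrMr ?mul1r//; exact: addr_gt0.
apply: (@cauchy_product _ _ (A + B)).
- by apply: bd aK => //; rewrite lerDl ltW.
- by apply: bd bL => //; rewrite lerDr ltW.
- by near: t.
- by near: t.
Unshelve. all: by end_near. Qed.

Lemma geometric_sum_le2 (x : R) m : 0 <= x <= 2^-1 -> \sum_(i < m) x ^+ i <= 2.
Proof.
move=> /andP[x0 x2]; elim: m => [|m IH]; first by rewrite big_ord0.
rewrite big_ord_recl expr0.
under eq_bigr do rewrite exprS.
rewrite -mulr_sumr; have : x * \sum_(i < m) x ^+ i <= 2^-1 * 2.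
  by rewrite ler_pM// sumr_ge0// => i _; rewrite exprn_ge0.
lra.
Qed.

(** If all coefficients below n vanish, the vanishing sum bounds |c_n| t^n by a
geometric tail of order t^(n+1); dividing by t^n and letting t tend to 0 gives
c_n = 0. *)
Lemma expansion0_eq0 c : expansion c (fun=> 0) -> forall n, c n = 0.
Proof.
move=> hc; have [A [K [A0 K0 cK]]] := expansion_bound hc.
have [t0 t0_gt0 ht] := expansion_at hc.
move=> n; elim/ltn_ind: n => n IH.
have key t : 0 < t -> t <= t0 -> K * t <= 2^-1 ->
    `|c n| <= 2 * A * K ^+ n.+1 * t.
  move=> t_gt0 tt0 Kt; have Kt0 : 0 <= K * t by rewrite mulr_ge0// ltW.
  rewrite -(@ler_pM2r _ (t ^+ n)) ?exprn_gt0//.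
  rewrite -[X in _ * X](ger0_norm (exprn_ge0 n (ltW t_gt0))) -normrM.
  apply/ler_addgt0Pr => e e0.
  have nt : `|t| <= t0 by rewrite ger0_norm// ltW.
  have /cvgrPdist_lt /(_ e e0) := ht t nt.
  case=> N _ /(_ (n.+1 + N)%N) /=; rewrite leq_addl sub0r normrN => /(_ isT).
  rewrite /series /= big_mkord big_split_ord /= big_ord_recr /=.
  rewrite big1 ?add0r => [sN|i _]; last by rewrite IH ?mul0r.
  have tail : `|\sum_(i < N) c (n.+1 + i)%N * t ^+ (n.+1 + i)| <=
      2 * A * (K * t) ^+ n.+1.
    rewrite (le_trans (ler_norm_sum _ _ _))//.
    apply: (@le_trans _ _ (\sum_(i < N) A * (K * t) ^+ n.+1 * (K * t) ^+ i)).
      apply: ler_sum => i _; rewrite -mulrA -exprD exprMn mulrA normrM.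
      by rewrite (ger0_norm (exprn_ge0 _ (ltW t_gt0))) ler_wpM2r ?exprn_ge0// ltW.
    rewrite -mulr_sumr mulrC -mulrA ler_wpM2r ?mulr_ge0 ?exprn_ge0 ?(ltW A0)//.
    by rewrite geometric_sum_le2// Kt0.
  rewrite (_ : _ * t * t ^+ n = 2 * A * (K * t) ^+ n.+1); last first.
    by rewrite exprMn [t ^+ n.+1]exprS; ring.
  have := ler_normB (c n * t ^+ n + \sum_(i < N) c (n.+1 + i)%N * t ^+ (n.+1 + i))
    (\sum_(i < N) c (n.+1 + i)%N * t ^+ (n.+1 + i)).
  rewrite addrK; lra.
apply/eqP; rewrite -normr_le0; apply/ler_addgt0Pr => e e0; rewrite add0r.
set C := 2 * A * K ^+ n.+1 in key.
have C0 : 0 < C by rewrite !mulr_gt0// exprn_gt0.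
(* The three bounds are those of the disc, of the geometric tail, and of e. *)
pose t := Num.min t0 (Num.min (2 * K)^-1 (e / C)).
have tgt0 : 0 < t by rewrite !lt_min t0_gt0 invr_gt0 mulr_gt0//= divr_gt0.
apply: (le_trans (key t tgt0 _ _)).
- by rewrite ge_min lexx.
- rewrite mulrC -ler_pdivlMr// -invfM /t !ge_min lexx orbT//.
- by rewrite mulrC -ler_pdivlMr// /t !ge_min lexx !orbT.
Qed.

Lemma eq_expansion a b f : expansion a f -> expansion b f -> a = b.
Proof.
move=> ha hb; apply/funext => n; apply/eqP; rewrite -subr_eq0; apply/eqP.
apply: (@expansion0_eq0 (fun n => a n - b n)); near=> t.
rewrite -[X in _ --> X](subrr (f t)).
rewrite (_ : series _ =
  (fun N => series (fun n => a n * t ^+ n) N - series (fun n => b n * t ^+ n) N)).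
  by apply: cvgB; near: t.
apply/funext => N; rewrite /series /= -sumrB; apply: eq_bigr => i _.
by rewrite mulrBl.
Unshelve. all: by end_near. Qed.

End PowerSeries.

(** * The degenerate exponential *)

Section Degenerate.
Context {R : realType}.
Implicit Types (lam x y z t c : R).

(** The coefficient of t^k in the power series of dexp, a degenerate analogue of
x^k / k!. *)
Definition dbin lam x (k : nat) : R := dfact lam x k / k`!%:R.

Lemma dbinS lam x k : k.+1%:R * dbin lam x k.+1 = (x - k%:R * lam) * dbin lam x k.
Proof.
rewrite /dbin /dfact big_ord_recr /= factS natrM.
have k1 : k.+1%:R != 0 :> R by rewrite pnatr_eq0.
have kf : k`!%:R != 0 :> R by rewrite pnatr_eq0 -lt0n fact_gt0.
by field; rewrite kf addrC natr1 k1.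
Qed.

(** The degenerate Vandermonde identity, by induction on n: multiply the
convolution by n + 1 = k + (n + 1 - k) and apply dbinS to either factor; the two
resulting linear factors add up to x + y - n lam. *)
Lemma dbinD lam x y n :
  dbin lam (x + y) n = conv (dbin lam x) (dbin lam y) n.
Proof.
elim: n => [|n IH].
  by rewrite /conv big_ord1 /dbin /dfact !big_ord0 fact0 !divr1 mulr1.
have n1 : n.+1%:R != 0 :> R by rewrite pnatr_eq0.
apply: (mulfI n1); rewrite dbinS IH /conv.
transitivity (\sum_(k < n.+2) (k%:R * dbin lam x k) * dbin lam y (n.+1 - k)%N +
    \sum_(k < n.+2) dbin lam x k * ((n.+1 - k)%N%:R * dbin lam y (n.+1 - k)%N)).
  rewrite [X in _ = X + _]big_ord_recl /= mul0r mul0r add0r [X in _ = _ + X]big_ord_recr /=.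
  rewrite subnn mul0r mulr0 addr0 mulr_sumr -big_split /=; apply: eq_bigr => k _.
  rewrite /bump /= add1n subSS dbinS subSn; last by rewrite -ltnS.
  rewrite dbinS natrB; last by rewrite -ltnS.
  ring.
rewrite -big_split mulr_sumr; apply: eq_bigr => k _ /=.
rewrite natrB; last by rewrite -ltnS.
ring.
Qed.

Lemma expr_fact_le_expR x k : 0 <= x -> x ^+ k / k`!%:R <= expR x.
Proof.
move=> x0; case: k => [|k].
  by rewrite expr0 fact0 divr1; have := expR_ge1Dx x; lra.
by have := expR_ge1Dxn k x0; lra.
Qed.

(** With u = |z| + k |lam| one has |(z)_{k,lam}| <= u^k, and c^k u^k / k! is at most
e^(c u).  The constant c is arbitrary, so that it can be taken inside the domain
of the moment generating function. *)
Lemma dbin_bound lam c z k : 0 < c ->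
  `|dbin lam z k| <= expR (c * `|z|) * (expR (c * `|lam|) / c) ^+ k.
Proof.
move=> c0; set u := `|z| + k%:R * `|lam|.
have u0 : 0 <= u by rewrite addr_ge0// mulr_ge0.
have h1 : `|dfact lam z k| <= u ^+ k.
  rewrite /dfact normr_prod -[X in _ <= _ ^+ X]card_ord -prodr_const.
  apply: ler_prod => i _; rewrite normr_ge0/= (le_trans (ler_normB _ _))//.
  by rewrite lerD2l normrM normr_nat ler_wpM2r// ler_nat ltnW.
rewrite /dbin normrM normfV normr_nat expr_div_n mulrA ler_pdivlMr ?exprn_gt0//.
apply: (@le_trans _ _ ((c * u) ^+ k / k`!%:R)).
  rewrite exprMn mulrC mulrA ler_wpM2r ?invr_ge0// ler_wpM2l ?exprn_ge0// ltW//.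
have cu0 : 0 <= c * u by rewrite mulr_ge0// ltW.
apply: (le_trans (expr_fact_le_expR k cu0)).
rewrite /u mulrDr expRD ler_wpM2l ?expR_ge0//.
by rewrite mulrCA [X in X <= _]expRM_natl.
Qed.

(** For |t| below this radius the k-th term of the series is dominated by
e^(c|z|) 8^-k, uniformly in z; the ratio 1/8 is the one of cauchy_product. *)
Definition dradius lam c := c * expR (- (c * `|lam|)) / 8.

Lemma dradius_gt0 lam c : 0 < c -> 0 < dradius lam c.
Proof. by move=> c0; rewrite /dradius divr_gt0// mulr_gt0// expR_gt0. Qed.

Lemma dterm_bound lam c z t k : 0 < c -> `|t| <= dradius lam c ->
  `|dbin lam z k * t ^+ k| <= expR (c * `|z|) * 8^-1 ^+ k.
Proof.
move=> c0 tr; rewrite normrM normrX.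
apply: (@le_trans _ _ (expR (c * `|z|) * (expR (c * `|lam|) / c) ^+ k *
   dradius lam c ^+ k)).
  by rewrite ler_pM ?exprn_ge0// ?dbin_bound// lerXn2r// nnegrE// (le_trans _ tr).
rewrite -mulrA -exprMn /dradius expRN.
rewrite (_ : _ / c * _ = 8^-1)//.
have e0 : expR (c * `|lam|) != 0 by rewrite lt0r_neq0// expR_gt0.
by field; rewrite e0 lt0r_neq0.
Qed.

Definition dpartial lam t z N : R := series (fun k => dbin lam z k * t ^+ k) N.

Lemma dpartial_bound lam c z t N : 0 < c -> `|t| <= dradius lam c ->
  `|dpartial lam t z N| <= 2 * expR (c * `|z|).
Proof.
move=> c0 tr; rewrite /dpartial /series /= big_mkord (le_trans (ler_norm_sum _ _ _))//.
apply: (@le_trans _ _ (\sum_(i < N) expR (c * `|z|) * 8^-1 ^+ i)).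
  by apply: ler_sum => i _; exact: dterm_bound.
rewrite -mulr_sumr mulrC ler_wpM2r ?expR_ge0// geometric_sum_le2//.
by rewrite invr_ge0 ler0n/= lef_pV2 ?posrE// ler_nat.
Qed.

Lemma dpartial_cvg lam c z t : 0 < c -> `|t| <= dradius lam c ->
  dpartial lam t z @ \oo --> dexp lam z t.
Proof.
move=> c0 tr; rewrite /dexp.
rewrite (_ : (fun k => dfact lam z k * (t ^+ k / k`!%:R)) =
   (fun k => dbin lam z k * t ^+ k)).
  apply: normed_cvg.
  apply: (@series_le_cvg _ _ (fun k => expR (c * `|z|) * 8^-1 ^+ k)).
  - by move=> n /=.
  - by move=> n /=; rewrite mulr_ge0 ?expR_ge0// exprn_ge0.
  - by move=> n; exact: dterm_bound.
  - apply: (@is_cvg_geometric_series R (expR (c * `|z|)) 8^-1).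
    by rewrite ger0_norm ?invr_ge0// invf_lt1// ltr1n.
by apply/funext => k; rewrite /dbin; ring.
Qed.

Lemma dexpD lam c x y t : 0 < c -> `|t| <= dradius lam c ->
  dexp lam (x + y) t = dexp lam x t * dexp lam y t.
Proof.
move=> c0 tr.
rewrite -(cvg_lim _ (dpartial_cvg (z := x + y) c0 tr))//; apply: cvg_lim => //.
rewrite (_ : dpartial _ _ _ = series (conv (fun k => dbin lam x k * t ^+ k)
   (fun k => dbin lam y k * t ^+ k))); last first.
  apply/funext => N; rewrite /dpartial /series /=; apply: eq_bigr => n _.
  rewrite dbinD /conv mulr_suml; apply: eq_bigr => k _.
  by rewrite [RHS]mulrACA -exprD subnKC// -ltnS.
apply: (@cauchy_product _ _ _ (expR (c * `|x|) + expR (c * `|y|))).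
- move=> n; apply: (le_trans (dterm_bound _ _ c0 tr)).
  by rewrite ler_wpM2r ?exprn_ge0// lerDl expR_ge0.
- move=> n; apply: (le_trans (dterm_bound _ _ c0 tr)).
  by rewrite ler_wpM2r ?exprn_ge0// lerDr expR_ge0.
- exact: dpartial_cvg c0 tr.
- exact: dpartial_cvg c0 tr.
Qed.

Lemma dexp_ge0 lam c z t : 0 < c -> `|t| <= dradius lam c -> 0 <= dexp lam z t.
Proof.
move=> c0 tr; rewrite (splitr z) (dexpD _ _ c0 tr) -expr2; exact: sqr_ge0.
Qed.

Lemma dexp0 lam c t : 0 < c -> `|t| <= dradius lam c -> dexp lam 0 t = 1.
Proof.
move=> c0 tr; rewrite -(cvg_lim _ (dpartial_cvg (z := 0) c0 tr))//; apply: cvg_lim => //.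
apply: (@cvg_near_cst _ _ _ _ _); exists 1%N => // N /= N0.
rewrite /dpartial /series /= big_mkord; case: N N0 => // N _.
rewrite big_ord_recl big1 ?addr0 => [|i _].
  by rewrite expr0 mulr1 /dbin /dfact big_ord0 fact0 divr1.
by rewrite /dbin /dfact big_ord_recl mul0r subr0 !mul0r.
Qed.

Lemma dexp_sum lam c t I (s : seq I) (F : I -> R) :
    0 < c -> `|t| <= dradius lam c ->
  dexp lam (\sum_(i <- s) F i) t = \prod_(i <- s) dexp lam (F i) t.
Proof.
move=> c0 tr; elim/big_rec2: _ => [|i u v _ <-]; first exact: dexp0 c0 tr.
exact: dexpD c0 tr.
Qed.

Lemma measurable_dfact lam k : measurable_fun setT (fun z => dfact lam z k).
Proof.
rewrite /dfact; apply: measurable_prod => i _.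
exact: measurable_funD.
Qed.

Lemma measurable_dbin lam k : measurable_fun setT (fun z => dbin lam z k).
Proof. by apply: measurable_funM => //; exact: measurable_dfact. Qed.

Lemma measurable_dexp lam c t : 0 < c -> `|t| <= dradius lam c ->
  measurable_fun setT (fun z => dexp lam z t).
Proof.
move=> c0 tr.
apply: (@measurable_fun_cvg _ _ _ _ (fun N z => dpartial lam t z N)).
- move=> N; rewrite /dpartial /series /=; apply: measurable_sum => k.
  by apply: measurable_funM => //; exact: measurable_dbin.
- by move=> z _; exact: dpartial_cvg c0 tr.
Qed.

End Degenerate.

(** * Exchanging expectation and series *)

Section Moments.
Context {d : measure_display} {T : measurableType d} {R : realType}.
Variables (P : probability T R) (lam c : R) (Z : T -> R).
Hypotheses (c0 : 0 < c) (mZ : measurable_fun setT Z).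
Hypothesis expZ : (\int[P]_w (expR (c * `|Z w|))%:E < +oo)%E.

Lemma integrable_expR_abs : P.-integrable setT (fun w => (expR (c * `|Z w|))%:E).
Proof.
apply/integrableP; split.
  apply/measurable_EFinP; apply: measurableT_comp => //.
  by apply: measurable_funM => //; apply: measurableT_comp.
by under eq_integral do rewrite gee0_abs ?lee_fin ?expR_ge0//.
Qed.

Lemma integrable_dbin k : P.-integrable setT (fun w => (dbin lam (Z w) k)%:E).
Proof.
apply: (@le_integrable _ _ _ _ _ _ _
  (fun w => ((expR (c * `|lam|) / c) ^+ k)%:E * (expR (c * `|Z w|))%:E)%E) => //.
- apply/measurable_EFinP; exact: (measurableT_comp (measurable_dbin lam k) mZ).
- move=> w _; rewrite -EFinM !abse_EFin lee_fin [leRHS]ger0_norm.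
    by rewrite mulrC dbin_bound.
  by rewrite mulr_ge0 ?expR_ge0// exprn_ge0// divr_ge0 ?expR_ge0// ltW.
- exact: integrableZl integrable_expR_abs.
Qed.

(** The partial sums of the series of dexp lam (Z w) t are dominated by
2 e^(c |Z w|), which is integrable. *)
Lemma expansion_moment :
  expansion (fun k => fine 'E_P[fun w => dfact lam (Z w) k] / k`!%:R)
            (fun t => fine 'E_P[fun w => dexp lam (Z w) t]).
Proof.
have r0 := dradius_gt0 lam c0.
exists (dradius lam c) => //= t /=; rewrite sub0r normrN => /ltW tr.
have [|||||iE _] := @dominated_convergence _ _ _ P setT measurableT
  (fun N w => (dpartial lam t (Z w) N)%:E) (fun w => (dexp lam (Z w) t)%:E)
  (fun w => 2%:E * (expR (c * `|Z w|))%:E)%E.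
- move=> N; apply/measurable_EFinP; rewrite /dpartial /series /=.
  apply: measurable_sum => k; apply: measurable_funM => //.
  by have /integrableP[/measurable_EFinP] := integrable_dbin k.
- apply/measurable_EFinP.
  exact: (measurableT_comp (measurable_dexp c0 tr) mZ).
- apply: aeW => w _; apply: cvg_EFin; first exact: nearW.
  exact: dpartial_cvg c0 tr.
- exact: integrableZl integrable_expR_abs.
- apply: aeW => w N _; rewrite -EFinM abse_EFin lee_fin.
  exact: dpartial_bound.
rewrite (_ : [sequence _]_N = fun N =>
    (series (fun n => fine 'E_P[fun w => dfact lam (Z w) n] / n`!%:R * t ^+ n) N)%:E).
  have fE := integrable_fin_num measurableT iE.
  have -> : fine 'E_P[fun w => dexp lam (Z w) t] =
      fine (\int[P]_w (dexp lam (Z w) t)%:E)%E by rewrite unlock.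
  by rewrite -[X in _ --> X -> _](fineK fE) => /fine_cvgP[].
apply/funext => N; rewrite /= /dpartial /series /=.
under eq_integral do rewrite -sumEFin.
rewrite (@integral_sum _ _ _ P setT measurableT).
  rewrite -sumEFin; apply: eq_bigr => k _.
  under eq_integral do rewrite mulrC EFinM.
  rewrite integralZl//; last exact: integrable_dbin.
  have fe := integrable_fin_num measurableT (integrable_dbin k).
  have kf : k`!%:R != 0 :> R by rewrite pnatr_eq0 -lt0n fact_gt0.
  have -> : (\int[P]_w (dbin lam (Z w) k)%:E =
     (fine 'E_P[fun w => dfact lam (Z w) k] / k`!%:R)%:E)%E.
    rewrite unlock.
    under [in RHS]eq_integral do rewrite -[dfact _ _ _](divfK kf) mulrC EFinM.
    rewrite integralZl//; last exact: integrable_dbin.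
    by rewrite fineM// [X in X / _]mulrC mulfK// fineK.
  by rewrite -EFinM mulrC.
move=> k; under eq_fun do rewrite mulrC EFinM.
by apply: integrableZl => //; exact: integrable_dbin.
Qed.

End Moments.

(** * Products of independent random variables *)

Section Independence.
Context {d : measure_display} {T : measurableType d} {R : realType}.
Variable P : probability T R.

Import HBNNSimple.

(** A simple function is a finite combination of indicators of its fibres. *)
Lemma indicator_factor_nnsfun (X : T -> R) (G : T -> R) (h : {nnsfun R >-> R}) :
    measurable_fun setT X -> measurable_fun setT G -> (forall w, 0 <= G w) ->
    (forall B, measurable B -> \int[P]_w (\1_B (X w) * G w)%:E =
       P (X @^-1` B) * \int[P]_w (G w)%:E)%E ->
  (\int[P]_w (h (X w) * G w)%:E =
   \int[P]_w (h (X w))%:E * \int[P]_w (G w)%:E)%E.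
Proof.
move=> mX mG G0 H.
have mh r : measurable (h @^-1` [set r]) by exact: measurable_funPTI.
have mhX r : measurable_fun setT (fun w => \1_(h @^-1` [set r]) (X w) : R).
  exact: (measurableT_comp (measurable_indic (mh r)) mX).
pose s := finmap.enum_fset (fset_set (range h)).
(* The maximum makes each term nonnegative for all r, not only for the values of h. *)
pose hr r w : R := Num.max r 0 * \1_(h @^-1` [set r]) (X w).
have hr0 r w : 0 <= hr r w by rewrite mulr_ge0// le_max lexx orbT.
have hE w : h (X w) = \sum_(r <- s) hr r w.
  rewrite fimfunE fsbig_finite//=; apply: eq_big_seq => r rr; rewrite /hr; congr (_ * _).
  apply/esym/max_idPl; move: rr; rewrite in_fset_set// inE => -[y _ <-].
  exact: fun_ge0.
have max0 r : (0 <= (Num.max r 0)%:E :> \bar R)%E by rewrite lee_fin le_max lexx orbT.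
have -> : (\int[P]_w (h (X w) * G w)%:E =
    \sum_(r <- s) ((Num.max r 0)%:E * (P (X @^-1` (h @^-1` [set r])) *
      \int[P]_w (G w)%:E)))%E.
  transitivity (\int[P]_w (\sum_(r <- s) (hr r w * G w)%:E))%E.
    by apply: eq_integral => w _; rewrite hE mulr_suml sumEFin.
  rewrite ge0_integral_sum//; last 2 first.
  - move=> r; apply/measurable_EFinP; apply: measurable_funM => //.
    by apply: measurable_funM.
  - by move=> r w _; rewrite lee_fin mulr_ge0.
  apply: eq_bigr => r _; rewrite -H//.
  under eq_integral do rewrite /hr -mulrA EFinM.
  rewrite ge0_integralZl//.
  - by apply/measurable_EFinP; exact: measurable_funM.
  - by move=> w _; rewrite lee_fin mulr_ge0.
have -> : (\int[P]_w (h (X w))%:E =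
    \sum_(r <- s) ((Num.max r 0)%:E * P (X @^-1` (h @^-1` [set r]))))%E.
  transitivity (\int[P]_w (\sum_(r <- s) (hr r w)%:E))%E.
    by apply: eq_integral => w _; rewrite hE sumEFin.
  rewrite ge0_integral_sum//; last 2 first.
  - by move=> r; apply/measurable_EFinP; apply: measurable_funM.
  - by move=> r w _; rewrite lee_fin.
  apply: eq_bigr => r _; under eq_integral do rewrite /hr EFinM.
  rewrite ge0_integralZl//.
  - rewrite (_ : \int[P]_w _ = \int[P]_w (\1_(X @^-1` (h @^-1` [set r])) w)%:E)%E.
      by rewrite integral_indic ?setIT// -[X in measurable X]setTI; exact: mX.
    by apply: eq_integral => w _; rewrite !indicE.
  - by apply/measurable_EFinP.
rewrite ge0_sume_distrl => [|r _]; last by rewrite mule_ge0.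
by apply: eq_bigr => r _; rewrite muleA.
Qed.

(** Monotone convergence along simple functions increasing to f.  Finiteness of
the integral of G makes multiplication by it continuous on the extended reals. *)
Lemma indicator_factor_ge0 (X : T -> R) (G : T -> R) (f : R -> R) :
    measurable_fun setT X -> measurable_fun setT G -> (forall w, 0 <= G w) ->
    (\int[P]_w (G w)%:E \is a fin_num)%E ->
    (forall B, measurable B -> \int[P]_w (\1_B (X w) * G w)%:E =
       P (X @^-1` B) * \int[P]_w (G w)%:E)%E ->
    measurable_fun setT f -> (forall y, 0 <= f y) ->
  (\int[P]_w (f (X w) * G w)%:E =
   \int[P]_w (f (X w))%:E * \int[P]_w (G w)%:E)%E.
Proof.
move=> mX mG G0 Gfin H mf f0.
have mEf : measurable_fun setT (EFin \o f) by exact/measurable_EFinP.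
have Ef0 y : setT y -> (0 <= (EFin \o f) y)%E by rewrite lee_fin.
pose h := nnsfun_approx measurableT mEf.
have hX y : (h n y)%:E @[n --> \oo] --> (f y)%:E.
  exact: (cvg_nnsfun_approx measurableT mEf Ef0).
have mhX n : measurable_fun setT (fun w => h n (X w)).
  by apply: measurableT_comp mX.
have hnd y : {homo (fun n => h n y) : m n / (m <= n)%N >-> m <= n}.
  by move=> m n mn; have /lefP := nd_nnsfun_approx measurableT mEf mn; exact.
have lim1 : (\int[P]_w (h n (X w) * G w)%:E @[n --> \oo] -->
    \int[P]_w (f (X w) * G w)%:E)%E.
  rewrite (_ : \int[P]_w (f (X w) * G w)%:E =
     \int[P]_w limn (fun n => (h n (X w) * G w)%:E))%E.
    apply: cvg_monotone_convergence => //.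
    - by move=> n; apply/measurable_EFinP; exact: measurable_funM.
    - by move=> n w _; rewrite lee_fin mulr_ge0.
    - by move=> w _ m n mn; rewrite lee_fin ler_wpM2r// hnd.
  apply: eq_integral => w _; apply/esym/cvg_lim => //.
  by under eq_fun do rewrite EFinM; rewrite EFinM; apply: cvgeZr.
have lim2 : (\int[P]_w (h n (X w))%:E @[n --> \oo] --> \int[P]_w (f (X w))%:E)%E.
  rewrite (_ : \int[P]_w (f (X w))%:E =
     \int[P]_w limn (fun n => (h n (X w))%:E))%E.
    apply: cvg_monotone_convergence => //.
    - by move=> n; apply/measurable_EFinP.
    - by move=> n w _; rewrite lee_fin.
    - by move=> w _ m n mn; rewrite lee_fin hnd.
  by apply: eq_integral => w _; apply/esym/cvg_lim.
have := cvgeZr Gfin lim2.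
under eq_fun do rewrite -indicator_factor_nnsfun//.
by move=> lim3; rewrite -(cvg_lim _ lim1)//; exact: cvg_lim.
Qed.

(** Indicators are replaced by general functions one variable at a time: the
induction hypothesis for J1, with the variable i moved among the indicators, is
the factorisation that indicator_factor_ge0 requires. *)
Lemma indep_expectation_prod_indic (X : {RV P >-> R}^nat) (f : nat -> R -> R)
    (J1 J2 : seq nat) (B : nat -> set R) :
    mutually_independent X -> uniq (J1 ++ J2) ->
    (forall j, measurable_fun setT (f j)) -> (forall j y, 0 <= f j y) ->
    (forall j, \int[P]_w (f j (X j w))%:E \is a fin_num)%E ->
    (forall j, measurable (B j)) ->
  (\int[P]_w (\prod_(j <- J1) f j (X j w) * \prod_(j <- J2) \1_(B j) (X j w))%:E =
   \prod_(j <- J1) \int[P]_w (f j (X j w))%:E * \prod_(j <- J2) P (X j @^-1` B j))%E.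
Proof.
move=> indep + mf f0 ffin; elim: J1 J2 B => [|i J1 IH] J2 B.
  move=> /= uJ2 mB; rewrite big_nil mul1e -indep//.
  transitivity (\int[P]_w (\1_(\bigcap_(j in [set` J2]) (X j @^-1` B j)) w)%:E)%E.
    apply: eq_integral => w _; rewrite big_nil mul1r indicE; congr _%:E.
    have [|nw] := boolP (w \in _).
      by rewrite inE => hw; apply: big1_seq => j jJ; rewrite indicE mem_set//; exact: hw.
    apply/eqP; rewrite prodf_seq_eq0; apply/negPn/negP; rewrite -all_predC => /allP h.
    move: nw; rewrite notin_setE; apply => j /h /=; rewrite indicE pnatr_eq0 eqb0 negbK.
    by rewrite inE.
  rewrite integral_indic ?setIT//; apply: fin_bigcap_measurable; first exact: finite_seq.
  by move=> j _; exact: measurable_funPTI.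
move=> /= /andP[iJ uJ] mB.
pose G w := \prod_(j <- J1) f j (X j w) * \prod_(j <- J2) \1_(B j) (X j w) : R.
have iJ2 : i \notin J2 by move: iJ; rewrite mem_cat negb_or => /andP[].
have IHG := IH J2 B uJ mB.
have Gfin : (\int[P]_w (G w)%:E \is a fin_num)%E.
  rewrite IHG fin_numM//; first by elim/big_ind: _ => // *; exact: fin_numM.
  elim/big_ind: _ => // [*|j _]; first exact: fin_numM.
  by rewrite fin_num_measure//; exact: measurable_funPTI.
have -> : (\int[P]_w (\prod_(j <- i :: J1) f j (X j w) *
    \prod_(j <- J2) \1_(B j) (X j w))%:E = \int[P]_w (f i (X i w) * G w)%:E)%E.
  by apply: eq_integral => w _; rewrite big_cons /G mulrA.
rewrite indicator_factor_ge0//.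
- by rewrite IHG big_cons muleA.
- apply: measurable_funM; apply: measurable_prod => j _.
    exact: (measurableT_comp (mf j)).
  exact: (measurableT_comp (measurable_indic (mB j)) (measurable_funPT (X j))).
- by move=> w; rewrite mulr_ge0// prodr_ge0.
- move=> B' mB'; rewrite IHG.
  pose B'' j := if j == i then B' else B j.
  have eqB j : j \in J2 -> B'' j = B j.
    by rewrite /B''; case: eqP => // -> jJ; rewrite jJ in iJ2.
  have := IH (i :: J2) B''.
  have -> : uniq (J1 ++ i :: J2).
    by rewrite (perm_uniq (permEl (perm_catCA J1 [:: i] J2))) /= iJ.
  have mB'' j : measurable (B'' j) by rewrite /B''; case: eqP.
  move=> /(_ isT mB''); rewrite big_cons {2}/B'' eqxx.
  rewrite [X in _ = (_ * (_ * X))%E -> _](eq_big_seq (fun j => P (X j @^-1` B j))); last first.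
    by move=> j jJ; rewrite eqB.
  rewrite muleCA => <-; apply: eq_integral => w _.
  rewrite big_cons /B'' eqxx /G mulrCA; congr (_ * (_ * _))%:E.
  by apply: eq_big_seq => j jJ; rewrite -/(B'' j) eqB.
Qed.
End Independence.

(** * Operations on expansions and the derangement polynomials *)

Section ExpansionExtra.
Context {R : realType}.
Implicit Types (a b c : R^nat) (f g : R -> R) (p : {poly R}).

Lemma eq_expansion_near c f g : (\forall t \near 0, f t = g t) ->
  expansion c f -> expansion c g.
Proof.
move=> fg cf; near=> t; have <- : f t = g t by near: t.
by near: t.
Unshelve. all: by end_near. Qed.

Lemma expansionD a b f g : expansion a f -> expansion b g ->
  expansion (fun n => a n + b n) (fun t => f t + g t).
Proof.
move=> ha hb; near=> t.
rewrite (_ : series _ =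
  (fun N => series (fun n => a n * t ^+ n) N + series (fun n => b n * t ^+ n) N)).
  by apply: cvgD; near: t.
apply/funext => N; rewrite /series /= -big_split; apply: eq_bigr => i _.
by rewrite mulrDl.
Unshelve. all: by end_near. Qed.

Lemma expansion_poly p : expansion (fun n => p`_n) (fun t => p.[t]).
Proof.
near=> t; apply: (@cvg_near_cst _ _ _ _ _); exists (size p) => // N /= sN.
by rewrite (horner_coef_wide t sN) /series /= big_mkord.
Unshelve. all: by end_near. Qed.

Lemma expansion_expR (y : R) :
  expansion (fun n => y ^+ n / n`!%:R) (fun t => expR (y * t)).
Proof.
near=> t; rewrite (_ : (fun n => _) = exp_coeff (y * t)).
  exact: is_cvg_series_exp_coeff.
by apply/funext => n; rewrite /exp_coeff /= exprMn mulrAC.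
Unshelve. all: by end_near. Qed.

(** Multiply the generating function by 1 - t and compare coefficients with those
of exp((x - 1) t). *)
Lemma derangement_rec (D : nat -> R -> R) x : is_derangement_polynomials D ->
  D 0%N x = 1 /\
  forall n, D n.+1 x / n.+1`!%:R - D n x / n`!%:R = (x - 1) ^+ n.+1 / n.+1`!%:R.
Proof.
move=> derD; pose q : {poly R} := 1 - 'X.
have h : conv (fun n => q`_n) (fun n => D n x / n`!%:R) =
    (fun n => (x - 1) ^+ n / n`!%:R).
  apply: eq_expansion (expansion_expR (x - 1)).
  apply: eq_expansion_near (expansionM (expansion_poly q)
    (is_egf_expansion (derD x))).
  exists 1 => //= t /=; rewrite sub0r normrN => t1.
  have -> : q.[t] = 1 - t by rewrite /q !hornerE.
  rewrite mulrA divff ?mul1r//.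
  by rewrite subr_eq0; apply/eqP => t1'; rewrite -t1' normr1 ltxx in t1.
have q0 : q`_0 = 1 by rewrite /q !coefE subr0.
have q1 : q`_1 = -1 by rewrite /q !coefE sub0r.
have q2 k : q`_k.+2 = 0 by rewrite /q !coefE subr0.
split.
  have := congr1 (fun f : R^nat => f 0%N) h.
  by rewrite /conv big_ord1 /= q0 fact0 !divr1 expr0 mul1r.
move=> n; have := congr1 (fun f : R^nat => f n.+1) h.
rewrite /conv 2!big_ord_recl big1 => [|i _]; last by rewrite q2 mul0r.
by rewrite /= /bump /= q0 q1 subn0 addn0 subSS subn0 mul1r mulN1r addr0 => ->.
Qed.

End ExpansionExtra.

(** * Sums of independent copies *)

Section IID.
Context {d : measure_display} {T : measurableType d} {R : realType}.
Variables (P : probability T R) (Y : {RV P >-> R}) (X : {RV P >-> R}^nat).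

Lemma same_law_integral (Z : {RV P >-> R}) (f : R -> R) : same_law Z Y ->
    measurable_fun setT f -> (forall y, 0 <= f y) ->
  (\int[P]_w (f (Z w))%:E = \int[P]_w (f (Y w))%:E)%E.
Proof.
move=> ZY mf f0; have mEf : measurable_fun setT (EFin \o f) by exact/measurable_EFinP.
have Ef0 y : (0 <= (EFin \o f) y)%E by rewrite lee_fin.
transitivity (\int[distribution P Z]_y (f y)%:E)%E.
  by rewrite ge0_integral_distribution.
transitivity (\int[distribution P Y]_y (f y)%:E)%E; last first.
  by rewrite ge0_integral_distribution.
by apply: eq_measure_integral => A mA _; exact: ZY.
Qed.

Hypothesis indep : mutually_independent X.
Hypothesis copies : forall j, same_law (X j) Y.

Lemma iid_expectation_prod (f : R -> R) m :
    measurable_fun setT f -> (forall y, 0 <= f y) ->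
    (\int[P]_w (f (Y w))%:E \is a fin_num)%E ->
  (\int[P]_w (\prod_(j < m) f (X j w))%:E =
   (fine (\int[P]_w (f (Y w))%:E) ^+ m)%:E)%E.
Proof.
move=> mf f0 ffin.
have := @indep_expectation_prod_indic _ _ _ P X (fun=> f) (iota 0 m) [::]
  (fun=> setT) indep.
rewrite cats0 iota_uniq => /(_ isT (fun=> mf) (fun=> f0)).
have fE j := same_law_integral (copies j) mf f0.
have ffin' j : (\int[P]_w (f (X j w))%:E \is a fin_num)%E by rewrite fE.
move=> /(_ ffin' (fun=> measurableT)); rewrite big_nil mule1.
under eq_integral do rewrite big_nil mulr1 -{1}(subn0 m) big_mkord.
move=> ->; rewrite -{1}(subn0 m) big_mkord.
elim: m => [|m IH]; first by rewrite big_ord0 expr0.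
by rewrite big_ord_recr /= IH fE exprSr EFinM fineK.
Qed.

Variable c : R.
Hypothesis c0 : 0 < c.
Hypothesis expY : (\int[P]_w (expR (c * `|Y w|))%:E < +oo)%E.

Lemma measurable_expR_abs : measurable_fun setT (fun y : R => expR (c * `|y|)).
Proof.
apply: measurableT_comp => //; apply: measurable_funM => //.
Qed.

Lemma measurable_partial_sum m : measurable_fun setT (partial_sum X m).
Proof. by rewrite /partial_sum; apply: measurable_sum => j. Qed.

(** e^(c |S_m|) is at most the product of the e^(c |X_j|), whose expectation
factors. *)
Lemma partial_sum_expR_abs m :
  (\int[P]_w (expR (c * `|partial_sum X m w|))%:E < +oo)%E.
Proof.
have ge0 y : 0 <= expR (c * `|y : R|) by exact: expR_ge0.
have fin : (\int[P]_w (expR (c * `|Y w|))%:E \is a fin_num)%E.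
  by rewrite ge0_fin_numE//; apply: integral_ge0 => w _; rewrite lee_fin.
have h := iid_expectation_prod m measurable_expR_abs ge0 fin.
apply: (@le_lt_trans _ _ (\int[P]_w (\prod_(j < m) expR (c * `|X j w|))%:E)%E);
  last by rewrite h ltry.
apply: ge0_le_integral => //.
- apply/measurable_EFinP.
  exact: (measurableT_comp measurable_expR_abs (measurable_partial_sum m)).
- apply/measurable_EFinP; apply: measurable_prod => j _.
  exact: (measurableT_comp measurable_expR_abs).
- move=> w _; rewrite lee_fin -expR_sum ler_expR -mulr_sumr.
  by rewrite ler_wpM2l ?(ltW c0)// /partial_sum ler_norm_sum.
Qed.

Variable lam : R.

Definition dmgf t := fine 'E_P[fun w => dexp lam (Y w) t].

Lemma dmgf_ge0 t : `|t| <= dradius lam c -> 0 <= dmgf t.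
Proof.
move=> tr; rewrite /dmgf unlock fine_ge0// integral_ge0// => w _.
by rewrite lee_fin (dexp_ge0 _ c0 tr).
Qed.

Lemma near_dradius : \forall t \near (0 : R), `|t| <= dradius lam c.
Proof.
exists (dradius lam c) => /=; first exact: dradius_gt0.
by move=> t /=; rewrite sub0r normrN => /ltW.
Qed.

Lemma dmgf_fin t : `|t| <= dradius lam c ->
  (\int[P]_w (dexp lam (Y w) t)%:E \is a fin_num)%E.
Proof.
move=> tr; rewrite ge0_fin_numE; last first.
  by apply: integral_ge0 => w _; rewrite lee_fin (dexp_ge0 _ c0 tr).
apply: (@le_lt_trans _ _ (\int[P]_w (2%:E * (expR (c * `|Y w|))%:E))%E).
  apply: ge0_le_integral => //.
  - by move=> w _; rewrite lee_fin (dexp_ge0 _ c0 tr).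
  - apply/measurable_EFinP; exact: (measurableT_comp (measurable_dexp c0 tr)).
  - apply: measurable_funeM; apply/measurable_EFinP.
    exact: (measurableT_comp measurable_expR_abs).
  - move=> w _; rewrite -EFinM lee_fin.
    apply: (cvgr_to_le (dpartial_cvg c0 tr)); apply: nearW => N.
    exact: le_trans (ler_norm _) (dpartial_bound _ _ c0 tr).
rewrite ge0_integralZl//; last first.
  apply/measurable_EFinP; exact: (measurableT_comp measurable_expR_abs).
by rewrite lte_mul_pinfty.
Qed.

(** By expansion_moment the sequence expands E[e_lam^(S_m)(t)], and e_lam^(S_m)(t) is
the product of the nonnegative variables e_lam^(X_j)(t). *)
Lemma expansion_dmoment m :
  expansion (fun k => dmoment lam X m k / k`!%:R) (fun t => dmgf t ^+ m).
Proof.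
apply: eq_expansion_near (expansion_moment lam c0 (measurable_partial_sum m)
  (partial_sum_expR_abs m)).
near=> t; have tr : `|t| <= dradius lam c by near: t; exact: near_dradius.
rewrite /dmgf unlock.
under eq_integral do rewrite /partial_sum (dexp_sum _ _ c0 tr).
rewrite (iid_expectation_prod m (measurable_dexp c0 tr))//.
- by move=> y; exact: dexp_ge0 c0 tr.
- exact: dmgf_fin.
Unshelve. all: by end_near. Qed.

End IID.

(** * Abel means of binomially weighted series *)

Section AbelMeans.
Context {R : realType}.
Implicit Types (y r : R) (j m N : nat).

(** Induction on j: Pascal's rule shows that the partial sums t_j satisfy
(1 - r) t_(j+1) <= r t_j. *)
Lemma binom_series_le r j N : 0 <= r < 1 ->
  \sum_(m < N) 'C(m, j)%:R * r ^+ m <= (1 - r)^-1 ^+ j.+1.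
Proof.
move=> /andP[r0 r1]; have r1' : 0 < 1 - r by rewrite subr_gt0.
have incr k : \sum_(m < N) 'C(m, k)%:R * r ^+ m <= \sum_(m < N.+1) 'C(m, k)%:R * r ^+ m.
  by rewrite big_ord_recr /= lerDl mulr_ge0// exprn_ge0.
elim: j => [|j IH].
  rewrite expr1 -(ler_pM2r r1') mulVf ?lt0r_neq0// mulrBr mulr1 lerBlDr.
  apply: (le_trans (incr 0%N)); rewrite big_ord_recl bin0 mul1r expr0 lerD2l.
  rewrite mulr_suml; apply: ler_sum => m _.
  by rewrite /= !bin0 !mul1r exprSr.
rewrite exprSr -ler_pdivrMr ?invr_gt0// invrK; apply: le_trans IH.
rewrite mulrBr mulr1 lerBlDr; apply: (le_trans (incr j.+1)).
rewrite big_ord_recl bin0n mul0r add0r mulr_suml -big_split /=.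
apply: ler_sum => m _; rewrite /bump /= add1n binS natrD mulrDl addrC exprS.
apply: lerD; first by rewrite [r * _]mulrC mulrA.
by rewrite ler_wpM2l// ler_piMl ?exprn_ge0// ltW.
Qed.

(** The first j terms vanish, and 'C(j + i, j) / (j + i)! = 1 / (i! j!). *)
Lemma cvg_binom_expR (z : R) j :
  series (fun m => 'C(m, j)%:R * (z ^+ m / m`!%:R)) @ \oo -->
    expR z * (z ^+ j / j`!%:R).
Proof.
rewrite -(cvg_shiftn j) /=.
rewrite (_ : (fun N => _) = (fun N => series (exp_coeff z) N * (z ^+ j / j`!%:R))).
  by apply: cvgMl; exact: is_cvg_series_exp_coeff.
apply/funext => N; rewrite /series /= !big_mkord addnC big_split_ord /=.
rewrite big1 ?add0r => [|i _]; last by rewrite bin_small ?mul0r.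
rewrite mulr_suml; apply: eq_bigr => i _; rewrite /exp_coeff /=.
have fn0 k : k`!%:R != 0 :> R by rewrite pnatr_eq0 -lt0n fact_gt0.
have := bin_fact (leq_addr i j); rewrite addKn => /(congr1 (fun k => k%:R : R)).
rewrite !natrM => <-; rewrite exprD.
have b0 : 'C(j + i, j)%:R != 0 :> R by rewrite pnatr_eq0 -lt0n bin_gt0 leq_addr.
by field; rewrite !fn0 b0.
Qed.

Variables (y : R) (delta : R^nat).
Hypothesis delta0 : delta 0%N = 1.
Hypothesis deltaS : forall m, delta m.+1 + delta m = y ^+ m.+1 / m.+1`!%:R.

(** The recurrence makes (-1)^m delta_m a partial sum of the series of e^(-y). *)
Lemma delta_bound m : `|delta m| <= expR `|y|.
Proof.
apply: (@le_trans _ _ (series (exp_coeff `|y|) m.+1)).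
  elim: m => [|m IH].
    by rewrite delta0 normr1 /series /= big_mkord big_ord1 /exp_coeff /= expr0 fact0 divr1.
  rewrite /series /= big_nat_recr//=.
  have -> : delta m.+1 = y ^+ m.+1 / m.+1`!%:R - delta m by rewrite -deltaS addrK.
  rewrite (le_trans (ler_normB _ _))// addrC lerD//.
  by rewrite /exp_coeff /= normrM normfV normr_nat normrX.
apply: nondecreasing_cvgn_le; last exact: is_cvg_series_exp_coeff.
by apply: nondecreasing_series => n _ _; exact: exp_coeff_ge0.
Qed.

Definition binom_delta j : R^nat := fun m => 'C(m, j)%:R * delta m.

Lemma is_cvg_binom_delta j r : 0 <= r < 1 ->
  cvgn (series (fun m => binom_delta j m * r ^+ m)).
Proof.
move=> r01; have r0 : 0 <= r by case/andP: r01.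
apply: normed_cvg.
apply: (@series_le_cvg _ _ (fun m => expR `|y| * ('C(m, j)%:R * r ^+ m))).
- by move=> m /=.
- by move=> m /=; rewrite !mulr_ge0 ?expR_ge0 ?exprn_ge0.
- move=> m /=; rewrite /binom_delta !normrM normr_nat (ger0_norm (exprn_ge0 _ r0)).
  rewrite mulrAC [leRHS]mulrC ler_wpM2l ?mulr_ge0 ?exprn_ge0//.
  exact: delta_bound.
- apply: nondecreasing_is_cvgn.
    by apply: nondecreasing_series => m _ _; rewrite !mulr_ge0 ?expR_ge0 ?exprn_ge0.
  exists (expR `|y| * (1 - r)^-1 ^+ j.+1) => _ [N _ <-].
  rewrite /series /= big_mkord -mulr_sumr ler_wpM2l ?expR_ge0//.
  exact: binom_series_le.
Qed.

(** L_(j-1), with L_(-1) = 0: the shift appearing in Pascal's rule. *)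
Definition abel_prev (L : nat -> R) j : R := if j is i.+1 then L i else 0.

(** Summing 'C(m, j) (delta_m + delta_(m-1)) r^m: the recurrence for delta gives the
exponential series, and Pascal's rule expresses the shifted sum by A_j and
A_(j-1). *)
Lemma abel_mean_rec j r : 0 <= r < 1 ->
  (1 + r) * abel_mean (binom_delta j) r +
    r * abel_prev (fun i => abel_mean (binom_delta i) r) j =
  expR (y * r) * ((y * r) ^+ j / j`!%:R).
Proof.
move=> r01.
pose s i N := series (fun m => binom_delta i m * r ^+ m) N.
have cs i : s i @ \oo --> abel_mean (binom_delta i) r by exact: is_cvg_binom_delta.
have cprev : (fun N => abel_prev (s^~ N) j) @ \oo -->
    abel_prev (fun i => abel_mean (binom_delta i) r) j.
  by case: (j) => [|i] /=; [exact: cvg_cst|exact: cs].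
have fin N : s j N.+1 + r * s j N + r * abel_prev (s^~ N) j =
    series (fun m => 'C(m, j)%:R * ((y * r) ^+ m / m`!%:R)) N.+1.
  rewrite /s /series /= !big_mkord [X in X + _ + _]big_ord_recl [RHS]big_ord_recl.
  rewrite /binom_delta delta0 mulr1 !expr0 fact0 divr1 -!addrA; congr (_ + _).
  have -> : abel_prev (fun i => \sum_(0 <= k < N) 'C(k, i)%:R * delta k * r ^+ k) j =
     \sum_(k < N) abel_prev (fun i => 'C(k, i)%:R) j * delta k * r ^+ k.
    case: (j) => [|i] /=; last by rewrite big_mkord.
    by rewrite big1// => k _; rewrite !mul0r.
  rewrite !mulr_sumr -!big_split /=; apply: eq_bigr => k _.
  rewrite /bump /= add1n.
  have -> : 'C(k.+1, j)%:R = 'C(k, j)%:R + abel_prev (fun i => 'C(k, i)%:R) j :> R.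
    by case: (j) => [|i]; rewrite /= ?bin0 ?addr0// binS natrD.
  have -> : (y * r) ^+ k.+1 / k.+1`!%:R = (delta k.+1 + delta k) * r ^+ k.+1.
    by rewrite deltaS exprMn mulrAC.
  rewrite exprS; ring.
have lhs : (fun N => s j N.+1 + r * s j N + r * abel_prev (s^~ N) j) @ \oo -->
    abel_mean (binom_delta j) r + r * abel_mean (binom_delta j) r +
    r * abel_prev (fun i => abel_mean (binom_delta i) r) j.
  apply: cvgD; last exact: cvgMr.
  apply: cvgD; last exact: cvgMr.
  by rewrite (cvg_shiftS (s j)).
rewrite mulrDl mul1r -(cvg_lim _ lhs)//; apply: cvg_lim => //.
under eq_fun do rewrite fin.
by have := @cvg_binom_expR (y * r) j; rewrite -cvg_shiftS.
Qed.

(** The solution of 2 A_j + A_(j-1) = e^y y^j / j!, the recurrence abel_mean_rec at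
r = 1. *)
Fixpoint abel_limit j : R :=
  (expR y * (y ^+ j / j`!%:R) - if j is i.+1 then abel_limit i else 0) / 2.

Lemma abel_limit_rec j :
  2 * abel_limit j + abel_prev abel_limit j = expR y * (y ^+ j / j`!%:R).
Proof. by case: j => [|i]; rewrite /= mulrC divfK// subrK. Qed.

Lemma near_at_left1 : \forall r \near (1 : R)^'-, 0 <= r < 1.
Proof.
near=> r; apply/andP; split; last by [].
by near: r; apply: nbhs_left_ge.
Unshelve. all: by end_near. Qed.

Lemma cvg_at_left1 (f : R -> R) : {for 1, continuous f} -> f r @[r --> 1^'-] --> f 1.
Proof. by move=> cf; apply: cvg_at_left_filter. Qed.

Lemma abel_mean_cvg j :
  abel_mean (binom_delta j) r @[r --> (1 : R)^'-] --> abel_limit j.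
Proof.
elim/ltn_ind: j => j IH.
have cprev : abel_prev (fun i => abel_mean (binom_delta i) r) j @[r --> (1 : R)^'-]
    --> abel_prev abel_limit j.
  by case: (j) IH => [_|i IH] /=; [exact: cvg_cst|exact: IH].
have cid : r @[r --> (1 : R)^'-] --> (1 : R) by apply: (cvg_at_left1 (f := id)).
have -> : abel_limit j =
    (expR (y * 1) * ((y * 1) ^+ j / j`!%:R) - 1 * abel_prev abel_limit j) / (1 + 1).
  by rewrite mulr1 -abel_limit_rec; field.
have key : (expR (y * r) * ((y * r) ^+ j / j`!%:R) -
     r * abel_prev (fun i => abel_mean (binom_delta i) r) j) / (1 + r)
   @[r --> (1 : R)^'-] -->
    (expR (y * 1) * ((y * 1) ^+ j / j`!%:R) - 1 * abel_prev abel_limit j) / (1 + 1).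
  have cyr : y * r @[r --> (1 : R)^'-] --> y * 1 by apply: cvgMr.
  apply: cvgM.
    apply: cvgB; last exact: cvgM.
    apply: cvgM; first by apply: continuous_cvg cyr; exact: continuous_expR.
    apply: cvgMl; exact: (cvg_comp (fun r => y * r) (fun z => z ^+ j) cyr
      (@exprn_continuous _ j (y * 1))).
  by apply: cvgV => //; apply: cvgD => //; exact: cvg_cst.
apply: cvg_trans key; apply: near_eq_cvg.
near=> r; have r01 : 0 <= r < 1 by near: r; exact: near_at_left1.
rewrite -(abel_mean_rec j r01) addrK mulrC mulKf//.
by rewrite lt0r_neq0//; case/andP: r01 => r0 _; rewrite ltr_pwDl.
Unshelve. all: by end_near. Qed.

Lemma abel_sum_binom_delta n (K : nat -> R) (a : R^nat) :
    a = (fun m => \sum_(j < n) K j * binom_delta j m) ->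
  abel_summable a /\ abel_sum a = \sum_(j < n) K j * abel_limit j.
Proof.
move=> ->; set b := fun m => _.
have sE r N : series (fun m => b m * r ^+ m) N =
    \sum_(j < n) K j * series (fun m => binom_delta j m * r ^+ m) N.
  rewrite /b /series /=; under eq_bigr do rewrite mulr_suml.
  rewrite exchange_big /=; apply: eq_bigr => j _; rewrite mulr_sumr.
  by apply: eq_bigr => k _; rewrite mulrA.
have cb r : 0 <= r < 1 -> series (fun m => b m * r ^+ m) @ \oo -->
    \sum_(j < n) K j * abel_mean (binom_delta j) r.
  move=> r01; rewrite (funext (sE r)).
  apply: cvg_big => [|j _]; first exact: add_continuous.
  apply: cvgMr; exact: is_cvg_binom_delta.
have lb : abel_mean b r @[r --> (1 : R)^'-] --> \sum_(j < n) K j * abel_limit j.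
  have h : \sum_(j < n) K j * abel_mean (binom_delta j) r @[r --> (1 : R)^'-] -->
      \sum_(j < n) K j * abel_limit j.
    apply: cvg_big => [|j _]; first exact: add_continuous.
    apply: cvgMr; exact: abel_mean_cvg.
  apply: cvg_trans h; apply: near_eq_cvg; near=> r.
  by apply/esym/cvg_lim => //; apply: cb; near: r; exact: near_at_left1.
split; last exact: cvg_lim.
by split; [move=> r /cb /cvgP|exact: cvgP lb].
Unshelve. all: by end_near. Qed.

End AbelMeans.

(** * Coefficients modulo a power of the variable *)

Section TruncatedSeries.
Context {R : realType}.
Implicit Types (p q U : {poly R}) (F : nat -> R).

Lemma sum_ord_trunc F a b : (a <= b)%N -> (forall i, (a <= i)%N -> F i = 0) ->
  \sum_(i < b) F i = \sum_(i < a) F i.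
Proof.
move=> ab F0; rewrite -(subnKC ab) big_split_ord /= [X in _ + X]big1 ?addr0//.
by move=> i _; rewrite F0 ?leq_addr.
Qed.

Lemma coefM_eq0 p q n : (forall i, (i <= n)%N -> p`_i = 0) -> (p * q)`_n = 0.
Proof. by move=> p0; rewrite coefM big1// => i _; rewrite p0 ?mul0r// -ltnS. Qed.

Lemma coef_expr_eq0 U k i : U`_0 = 0 -> (i < k)%N -> (U ^+ k)`_i = 0.
Proof.
move=> U0; have /factor_theorem[V ->] : root U 0 by rewrite /root horner_coef0 U0.
by move=> ik; rewrite subr0 exprMn coefMXn ik.
Qed.

(** Cutting the binomial sum at n instead of m is harmless: U^j has no terms below
degree j, and the binomial coefficient vanishes for j > m. *)
Lemma coef_exprD1 U m n : U`_0 = 0 ->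
  ((1 + U) ^+ m)`_n = \sum_(j < n.+1) 'C(m, j)%:R * (U ^+ j)`_n.
Proof.
move=> U0; rewrite exprDn coef_sum.
under eq_bigr do rewrite expr1n mul1r coefMn -mulr_natl.
rewrite -(@sum_ord_trunc (fun j => 'C(m, j)%:R * (U ^+ j)`_n) m.+1 (m.+1 + n.+1)).
- apply: (@sum_ord_trunc (fun j => 'C(m, j)%:R * (U ^+ j)`_n)); first exact: leq_addl.
  by move=> i ni; rewrite coef_expr_eq0// mulr0.
- exact: leq_addr.
- by move=> i mi; rewrite bin_small// mul0r.
Qed.

(** Modulo terms of degree above n, the hypotheses read E (2 + U) = 2 and
(2 + U) W = 2 B with W = \sum_j w_j U^j; hence 2 B E = (2 + U) W E = 2 W. *)
Lemma coef_quotient U n (b w : nat -> R) (E : {poly R}) :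
    U`_0 = 0 ->
    (forall j, 2 * w j + abel_prev w j = 2 * b j) ->
    (forall i, (i <= n)%N -> (E * (2%:P + U))`_i = (2%:P : {poly R})`_i) ->
  ((\sum_(k < n.+1) b k *: U ^+ k) * E)`_n = \sum_(j < n.+1) w j * (U ^+ j)`_n.
Proof.
move=> U0 wb hE; set B := \sum_(k < _) _.
pose W := \sum_(k < n.+1) w k *: U ^+ k.
have eWB : (2%:P + U) * W = 2%:P * B + w n *: U ^+ n.+1.
  have -> : w n *: U ^+ n.+1 =
      U * W - \sum_(k < n.+1) abel_prev w k *: U ^+ k.
    apply/eqP; rewrite eq_sym subr_eq; apply/eqP.
    rewrite [in RHS]big_ord_recl /= scale0r add0r mulr_sumr big_ord_recr /= addrC.
    congr (_ + _); first by rewrite -scalerAr -exprS.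
    by apply: eq_bigr => i _; rewrite /bump /= -scalerAr -exprS.
  rewrite mulrDl [LHS]addrC addrA [X in X - _]addrC -addrA; congr (_ + _).
  rewrite /W /B !mulr_sumr -sumrB; apply: eq_bigr => k _.
  rewrite !mul_polyC !scalerA -scalerBl -wb; congr (_ *: _); ring.
have key : (2%:P * (B * E))`_n = (2%:P * W)`_n.
  apply/eqP; rewrite -subr_eq0 -coefB; apply/eqP.
  have -> : 2%:P * (B * E) - 2%:P * W =
     (E * (2%:P + U) - 2%:P) * W - U ^+ n.+1 * (w n *: E).
    have -> : 2%:P * (B * E) = ((2%:P + U) * W - w n *: U ^+ n.+1) * E.
      by rewrite eWB addrK mulrA.
    rewrite -!mul_polyC; ring.
  rewrite coefB !coefM_eq0 ?subr0// => i ni.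
    by rewrite coef_expr_eq0.
  by rewrite coefB hE ?subrr.
have two0 : 2 != 0 :> R by rewrite pnatr_eq0.
apply: (mulfI two0); rewrite -coefCM key coefCM coef_sum; congr (_ * _).
by apply: eq_bigr => j _; rewrite coefZ.
Qed.

End TruncatedSeries.

(** * Stirling, Bell and Euler numbers as coefficients *)

Section ProbabilisticStirling.
Context {d : measure_display} {T : measurableType d} {R : realType}.
Variables (P : probability T R) (Y : {RV P >-> R}) (X : {RV P >-> R}^nat).
Hypothesis indep : mutually_independent X.
Hypothesis copies : forall j, same_law (X j) Y.
Variables c lam : R.
Hypothesis c0 : 0 < c.
Hypothesis expY : (\int[P]_w (expR (c * `|Y w|))%:E < +oo)%E.

Let mu m i : R := dmoment lam X m i / i`!%:R.

Let fact_neq0 k : k`!%:R != 0 :> R.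
Proof. by rewrite pnatr_eq0 -lt0n fact_gt0. Qed.

Lemma dmoment0 m : dmoment lam X m 0 = 1.
Proof.
rewrite /dmoment (_ : (fun w => _) = cst 1) ?expectation_cst//.
by apply/funext => w; rewrite /dfact big_ord0.
Qed.

Lemma dmoment_sum0 : mu 0 = fun i => (1 : {poly R})`_i.
Proof.
apply: (eq_expansion (expansion_dmoment indep copies c0 expY lam 0)).
apply: eq_expansion_near (expansion_poly 1); near=> t.
by rewrite hornerC expr0.
Unshelve. all: by end_near. Qed.

Lemma dmomentS m : mu m.+1 = conv (mu 1) (mu m).
Proof.
have h k := expansion_dmoment indep copies c0 expY lam k.
apply: (eq_expansion (h m.+1)); apply: eq_expansion_near (expansionM (h 1%N) (h m)).
by near=> t; rewrite expr1 exprS.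
Unshelve. all: by end_near. Qed.

(** The denominator E[e_lam^Y(t)] + 1 is positive near 0, so that multiplying by it
yields the constant 2. *)
Lemma euler_conv (eul : R^nat) : is_euler_numbers lam Y eul ->
  conv (fun i => eul i / i`!%:R) (fun i => mu 1 i + (1 : {poly R})`_i) =
  fun i => (2%:P : {poly R})`_i.
Proof.
move=> /is_egf_expansion heul.
have h := expansion_dmoment indep copies c0 expY lam 1.
apply: (eq_expansion (expansionM heul (expansionD h (expansion_poly 1)))).
apply: eq_expansion_near (expansion_poly 2%:P); near=> t.
have tr : `|t| <= dradius lam c by near: t; exact: near_dradius.
rewrite !hornerC expr1 divfK// lt0r_neq0// ltr_wpDl//.
exact: (dmgf_ge0 Y c0 tr).
Unshelve. all: by end_near. Qed.

Variable n : nat.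

Definition dmgf_poly : {poly R} := \poly_(i < n.+1) mu 1 i.
(** The series U truncated above degree n; its constant term is 0 because M(0) = 1. *)
Definition dmgf_polyB1 : {poly R} := dmgf_poly - 1.

Lemma coef_dmgf_poly_exp m i : (i <= n)%N -> (dmgf_poly ^+ m)`_i = mu m i.
Proof.
elim: m i => [|m IH] i ni; first by rewrite expr0 dmoment_sum0.
rewrite exprS coefM dmomentS; apply: eq_bigr => k _.
have ki : (k <= i)%N by rewrite -ltnS.
by rewrite coef_poly ltnS (leq_trans ki ni) IH// (leq_trans (leq_subr _ _)).
Qed.

Lemma coef0_dmgf_polyB1 : dmgf_polyB1`_0 = 0.
Proof.
by rewrite coefB coef_poly /= /mu dmoment0 fact0 divr1 coef1 subrr.
Qed.

Lemma dmomentE m : dmoment lam X m n =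
  n`!%:R * \sum_(j < n.+1) 'C(m, j)%:R * (dmgf_polyB1 ^+ j)`_n.
Proof.
rewrite -coef_exprD1 ?coef0_dmgf_polyB1// /dmgf_polyB1 addrC subrK.
by rewrite coef_dmgf_poly_exp// mulrC divfK.
Qed.

(** The alternating sum in the definition is the binomial expansion of (M - 1)^k. *)
Lemma stirling2E i k : (i <= n)%N ->
  stirling2 lam X i k = i`!%:R / k`!%:R * (dmgf_polyB1 ^+ k)`_i.
Proof.
move=> ni; rewrite /stirling2 /dmgf_polyB1 [_ - 1]addrC exprDn coef_sum.
rewrite [i`!%:R / _]mulrC -mulrA; congr (_ * _); rewrite mulr_sumr.
apply: eq_bigr => j _.
rewrite (_ : -1 = (-1)%:P :> {poly R}); last by rewrite polyCN.
rewrite -polyC_exp -mulrnAr coefCM coefMn coef_dmgf_poly_exp//.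
rewrite /mu -mulr_natl; field; exact: fact_neq0.
Qed.

Lemma bellE i y : (i <= n)%N ->
  bell lam X i y =
  i`!%:R * (\sum_(k < n.+1) (y ^+ k / k`!%:R) *: dmgf_polyB1 ^+ k)`_i.
Proof.
move=> ni; rewrite coef_sum /bell mulr_sumr.
rewrite (@sum_ord_trunc _ (fun k =>
  i`!%:R * ((y ^+ k / k`!%:R) *: dmgf_polyB1 ^+ k)`_i) i.+1 n.+1)//.
  apply: eq_bigr => k _; rewrite stirling2E// coefZ; ring.
by move=> k ik; rewrite coefZ coef_expr_eq0 ?coef0_dmgf_polyB1// !mulr0.
Qed.

(** Both factors of the convolution are coefficients of polynomials in U, and
coef_quotient evaluates the product from the recurrence for w. *)
Lemma bell_euler_conv (eul w : R^nat) y : is_euler_numbers lam Y eul ->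
    (forall j, 2 * w j + abel_prev w j = 2 * (y ^+ j / j`!%:R)) ->
  \sum_(m < n.+1) 'C(n, m)%:R * bell lam X m y * eul (n - m)%N =
  n`!%:R * \sum_(j < n.+1) w j * (dmgf_polyB1 ^+ j)`_n.
Proof.
move=> heul hw; pose E : {poly R} := \poly_(i < n.+1) (eul i / i`!%:R).
have hE i : (i <= n)%N -> (E * (2%:P + dmgf_polyB1))`_i = (2%:P : {poly R})`_i.
  move=> ni; rewrite -(congr1 (fun f : R^nat => f i) (euler_conv heul)) coefM.
  apply: eq_bigr => k _; have ki : (k <= i)%N by rewrite -ltnS.
  rewrite coef_poly ltnS (leq_trans ki ni); congr (_ * _).
  have -> : 2%:P + dmgf_polyB1 = dmgf_poly + 1.
    by rewrite /dmgf_polyB1 (_ : 2%:P = 1 + 1) ?polyCD//; ring.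
  by rewrite coefD coef_poly ltnS (leq_trans (leq_subr _ _)).
rewrite -(coef_quotient coef0_dmgf_polyB1 hw hE) coefM mulr_sumr.
apply: eq_bigr => m _; have mn : (m <= n)%N by rewrite -ltnS.
rewrite bellE// coef_poly ltnS leq_subr -(bin_fact mn) !natrM.
by field; rewrite fact_neq0.
Qed.

End ProbabilisticStirling.

(** e^(c|y|) <= e^(c y) + e^(-c y). *)
Lemma mgf_expR_abs (d : measure_display) (T : measurableType d) (R : realType)
    (P : probability T R) (Y : {RV P >-> R}) (c : R) :
    ('M_P Y c < +oo)%E -> ('M_P Y (- c) < +oo)%E ->
  (\int[P]_w (expR (c * `|Y w|))%:E < +oo)%E.
Proof.
rewrite /mmt_gen_fun unlock => h1 h2.
have mexp a : measurable_fun setT (fun w => expR (Y w * a)).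
  by apply: measurableT_comp => //; exact: measurable_funM.
apply: (@le_lt_trans _ _ (\int[P]_w ((expR (Y w * c))%:E + (expR (Y w * - c))%:E))%E).
  apply: ge0_le_integral => //.
  - apply/measurable_EFinP; exact: (measurableT_comp (measurable_expR_abs c)).
  - by apply/measurable_EFinP; exact: measurable_funD.
  - move=> w _; rewrite -EFinD lee_fin; have [y0|y0] := lerP 0 (Y w).
      by rewrite (ger0_norm y0) [c * _]mulrC lerDl expR_ge0.
    by rewrite (ltr0_norm y0) mulrN mulrN [c * _]mulrC lerDr expR_ge0.
rewrite ge0_integralD//.
- exact: lte_add_pinfty.
- exact/measurable_EFinP.
- exact/measurable_EFinP.
Qed.

Theorem theorem2p6 (d : measure_display) (T : measurableType d) (R : realType)
  (P : probability T R) (lam : R) (lam_neq0 : lam != 0)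
  (Y : {RV P >-> R})
  (mgfY : exists2 r : R, 0 < r &
    forall t : R, `|t| < r -> ('M_P Y t < +oo)%E)
  (Ys : {RV P >-> R}^nat)
  (indep : mutually_independent Ys)
  (copies : forall j, same_law (Ys j) Y)
  (D : nat -> R -> R) (derD : is_derangement_polynomials D)
  (eul : R^nat) (eulerE : is_euler_numbers lam Y eul)
  (x : R) (n : nat) :
  let a := fun m : nat =>
    (-1) ^+ m / m`!%:R * D m x * dmoment lam Ys m n in
  abel_summable a /\
  \sum_(m < n.+1) 'C(n, m)%:R * bell lam Ys m (1 - x) * eul (n - m)%N =
  2 * expR (x - 1) * abel_sum a.
Proof.
move=> a; have [r r0 mgfr] := mgfY.
pose c := r / 2; have c0 : 0 < c by rewrite divr_gt0.
have cr : `|c| < r by rewrite gtr0_norm// ltr_pdivrMr// ltr_pMr// ltr1n.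
have expY : (\int[P]_w (expR (c * `|Y w|))%:E < +oo)%E.
  by apply: mgf_expR_abs; apply: mgfr; rewrite ?normrN.
have [D0 DS] := derangement_rec x derD.
pose delta m := (-1) ^+ m * (D m x / m`!%:R).
have delta0 : delta 0%N = 1 by rewrite /delta expr0 D0 fact0 divr1 mul1r.
have deltaS m : delta m.+1 + delta m = (1 - x) ^+ m.+1 / m.+1`!%:R.
  have -> : delta m.+1 + delta m =
      (-1) ^+ m.+1 * (D m.+1 x / m.+1`!%:R - D m x / m`!%:R).
    by rewrite /delta exprS; ring.
  by rewrite DS mulrA -exprMn mulN1r opprB.
pose U := dmgf_polyB1 Ys lam n.
(* Expanding the moment in binomials splits the series into Abel means. *)
have aE : a = fun m =>
    \sum_(j < n.+1) (n`!%:R * (U ^+ j)`_n) * binom_delta delta j m.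
  apply/funext => m; rewrite /a (dmomentE indep copies lam c0 expY).
  rewrite mulrCA mulr_sumr mulr_sumr; apply: eq_bigr => j _.
  by rewrite /binom_delta /delta -/U; ring.
have [sa ->] := abel_sum_binom_delta (K := fun j => n`!%:R * (U ^+ j)`_n)
  delta0 deltaS aE; split => //.
pose w j := 2 * expR (x - 1) * abel_limit (1 - x) j.
have wrec j : 2 * w j + abel_prev w j = 2 * ((1 - x) ^+ j / j`!%:R).
  have -> : 2 * w j + abel_prev w j = 2 * expR (x - 1) *
      (2 * abel_limit (1 - x) j + abel_prev (abel_limit (1 - x)) j).
    by rewrite mulrDr [2 * w j]mulrCA; case: (j) => [|i] //=; rewrite !mulr0.
  rewrite abel_limit_rec mulrA -[_ * _ * expR _]mulrA -expRD.
  by rewrite -[x - 1]opprB addNr expR0 mulr1.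
rewrite (bell_euler_conv indep copies c0 expY n eulerE wrec).
rewrite !mulr_sumr; apply: eq_bigr => j _; rewrite /w -/U; ring.
Qed.
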